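(* Let $M$ be an $m$-dimensional differential manifold, let $N$ be a connected $n$-dimensional differential manifold, and let $f:M\to N$ be a $C^1$-map such that (1) $f$ has at least one regular point; (2) $f(M)$ is closed in $N$; (3) the set $C_f\subset M$ of all critical points of $f$ satisfies $\dim C_f<n-1$. Then $f$ is surjective.
   Context: Differential manifolds are smooth manifolds without boundary in the usual sense (Hausdorff, second countable). A point $p\in M$ is a regular point of a $C^1$-map $f:M\to N$ if the differential $df_p:T_pM\to T_{f(p)}N$ is surjective; otherwise $p$ is a critical point of $f$. Dimension of subsets: let $\mathcal H^s$ denote the $s$-dimensional Hausdorff measure on $\mathbb R^m$. A subset $E$ of an $m$-dimensional differential manifold $M$ is said to be of $\mathcal H^s$-measure zero if $\mathcal H^s(\varphi(E\cap U))=0$ for every coordinate chart $(U,\varphi)$ of $M$. The dimension of $E$ is $\dim E=\inf\{s>0 : E \text{ is of } \mathcal H^s\text{-measure zero}\}$ (equivalently, its Hausdorff dimension under any smooth embedding of $M$ in a Euclidean space). *)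

(* Defs.v *)
From HB Require Import structures.
From mathcomp Require Import all_boot all_order all_algebra.
From mathcomp Require Import all_classical all_reals all_analysis.
Set Implicit Arguments.
Unset Strict Implicit.
Unset Printing Implicit Defensive.
Import Order.TTheory GRing.Theory Num.Theory.
Import numFieldNormedType.Exports.
Local Open Scope classical_set_scope.
Local Open Scope ring_scope.

(** * C^k maps between open subsets of Euclidean spaces *)

(* Maps are total; only their germs at the points of [A] matter, so this is
   the usual notion when [A] is open. *)
Fixpoint Ck_on (R : realType) (m n k : nat) (A : set 'rV[R]_m)
    (f : 'rV[R]_m -> 'rV[R]_n) : Prop :=
  match k with
  | 0 => forall x, A x -> {for x, continuous f}
  | k'.+1 => (forall x, A x -> differentiable f x) /\
             (forall v, Ck_on k' A (fun x => 'D_v f x))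
  end.

Definition smooth_on (R : realType) (m n : nat) (A : set 'rV[R]_m)
    (f : 'rV[R]_m -> 'rV[R]_n) : Prop :=
  forall k, Ck_on k A f.

(** * Smooth manifolds *)

(* [chart_map] and [chart_inv] are total functions, meaningful only on
   [chart_dom] and on its image respectively. *)
Record chart (R : realType) (T : topologicalType) (m : nat) := Chart {
  chart_dom : set T ;
  chart_map :> T -> 'rV[R]_m ;
  chart_inv : 'rV[R]_m -> T ;
  chart_dom_open : open chart_dom ;
  chart_image_open : open (chart_map @` chart_dom) ;
  chart_mapK : forall p, chart_dom p -> chart_inv (chart_map p) = p ;
  chart_map_continuous :
    forall p, chart_dom p -> {for p, continuous chart_map} ;
  chart_inv_continuous :
    forall x, (chart_map @` chart_dom) x -> {for x, continuous chart_inv}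
}.

Definition smooth_compatible (R : realType) (T : topologicalType) (m : nat)
    (a b : chart R T m) : Prop :=
  smooth_on (a @` (chart_dom a `&` chart_dom b)) (b \o chart_inv a) /\
  smooth_on (b @` (chart_dom a `&` chart_dom b)) (a \o chart_inv b).

(* The smooth structure is given by its maximal atlas, whose members are the
   coordinate charts of the manifold. *)
Record manifold (R : realType) (m : nat) := Manifold {
  manifold_carrier :> topologicalType ;
  manifold_hausdorff : hausdorff_space manifold_carrier ;
  manifold_second_countable : @second_countable manifold_carrier ;
  atlas : set (chart R manifold_carrier m) ;
  atlas_cover : forall p, exists2 a, atlas a & chart_dom a p ;
  atlas_compatible : forall a b, atlas a -> atlas b -> smooth_compatible a b ;
  atlas_maximal :
    forall c, (forall a, atlas a -> smooth_compatible a c) -> atlas c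
}.

Record chart_at (R : realType) (m : nat) (M : manifold R m) (p : M) := ChartAt {
  chart_at_chart :> chart R M m ;
  chart_at_atlas : atlas chart_at_chart ;
  chart_at_dom : chart_dom chart_at_chart p
}.

(** * Tangent spaces, C^1 maps and their differentials *)

(* A tangent vector at [p] is a family of coordinate vectors, one for each
   coordinate chart around [p], transforming by the differentials of the
   transition maps. *)
Record tangent (R : realType) (m : nat) (M : manifold R m) (p : M) := Tangent {
  tangent_coord :> chart_at p -> 'rV[R]_m ;
  tangent_change : forall a b : chart_at p,
    tangent_coord b = 'd (b \o chart_inv a) (a p) (tangent_coord a)
}.

Definition C1_map (R : realType) (m n : nat) (M : manifold R m)
    (N : manifold R n) (f : M -> N) : Prop :=
  continuous f /\
  forall (a : chart R M m) (b : chart R N n), atlas a -> atlas b ->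
    Ck_on 1 (a @` (chart_dom a `&` f @^-1` chart_dom b))
      (b \o f \o chart_inv a).

(* [is_differential f v w] is the graph of df_p : T_p M -> T_(f p) N, that is
   df_p(v) = w. *)
Definition is_differential (R : realType) (m n : nat) (M : manifold R m)
    (N : manifold R n) (f : M -> N) (p : M) (v : tangent p)
    (w : tangent (f p)) : Prop :=
  forall (a : chart_at p) (b : chart_at (f p)),
    w b = 'd (b \o f \o chart_inv a) (a p) (v a).

Definition regular_point (R : realType) (m n : nat) (M : manifold R m)
    (N : manifold R n) (f : M -> N) (p : M) : Prop :=
  forall w : tangent (f p), exists v : tangent p, is_differential v w.

Definition critical_set (R : realType) (m n : nat) (M : manifold R m)
    (N : manifold R n) (f : M -> N) : set M :=
  [set p | ~ regular_point f p].

(** * Hausdorff measure and dimension *)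

(* The norm of ['rV[R]_m] is the sup norm, hence this definition. *)
Definition euclidean_dist (R : realType) (m : nat) (x y : 'rV[R]_m) : R :=
  Num.sqrt (\sum_(i < m) (x 0 i - y 0 i) ^+ 2).

Definition diameter (R : realType) (m : nat) (A : set 'rV[R]_m) : \bar R :=
  ereal_sup [set (euclidean_dist x y)%:E | x in A & y in A].

(* Empty members of a cover are skipped, so that they contribute 0 for every
   exponent, including s = 0. *)
Definition hausdorff_content (R : realType) (m : nat) (s delta : R)
    (A : set 'rV[R]_m) : \bar R :=
  ereal_inf
    [set (\sum_(0 <= i <oo | U i != set0) poweR (diameter (U i)) s)%E
    | U in [set U : nat -> set 'rV[R]_m |
        A `<=` \bigcup_i U i /\ forall i, (diameter (U i) <= delta%:E)%E]].

(* No normalizing constant: only the null sets are used. *)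
Definition hausdorff_measure (R : realType) (m : nat) (s : R)
    (A : set 'rV[R]_m) : \bar R :=
  ereal_sup [set hausdorff_content s delta A | delta in [set d : R | 0 < d]].

Definition hausdorff_null (R : realType) (m : nat) (M : manifold R m) (s : R)
    (E : set M) : Prop :=
  forall a : chart R M m, atlas a ->
    hausdorff_measure s (a @` (E `&` chart_dom a)) = 0%E.

Definition dim_subset (R : realType) (m : nat) (M : manifold R m) (E : set M) :
    \bar R :=
  ereal_inf [set s%:E | s in [set s : R | 0 < s /\ hausdorff_null s E]].

(* Main.v *)
Require Import Defs.
From HB Require Import structures.
From mathcomp Require Import all_boot all_order all_algebra.
From mathcomp Require Import all_classical all_reals all_analysis.
From mathcomp Require Import ring lra.
Import Order.TTheory GRing.Theory Num.Theory.
Import numFieldNormedType.Exports.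
Local Open Scope classical_set_scope.
Local Open Scope ring_scope.
Set Implicit Arguments.
Unset Strict Implicit.
Unset Printing Implicit Defensive.

(** Let [A] be the interior of [f(M)].  It is not empty, because [f] is open at
    a regular point, and if it were closed, connectedness would give [A = N].
    Otherwise some [q] lies in the closure of [A] but not in [A].  As [f(M)] is
    closed, [q] is in the closure of both of the disjoint open sets [A] and
    [N \ f(M)], and whatever they leave out of [N] is made of values of [f]
    outside the interior of [f(M)], hence of critical values.  A [C^1] map does
    not raise Hausdorff dimension, so in a chart around [q] two disjoint
    nonempty open subsets of a ball of [R^n] would fill that ball up to a set of
    [H^(n-1)]-measure zero.  This is impossible: project the ball along the
    direction joining a point of one set to a point of the other.  The
    projection of the exceptional set is still null, so it cannot cover an open
    set of [R^(n-1)], and some line parallel to that direction goes from one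
    open set to the other without meeting anything else, against the
    connectedness of segments.

    The ingredients are [submersion_nbhs] (a [C^1] map with surjective
    differential is open at the point), [null_set_C1_image] (critical values
    are null), [ball_not_null] (a ball of [R^k] is not [H^k]-null, by counting
    the points of a fine grid) and [null_set_nonseparating] (the projection
    argument).  Null sets are transported by differentiable maps because such
    a map is, up to a countable decomposition of its domain, Lipschitz at a
    fixed scale.

    Since dimensions are nonnegative, the hypothesis on the critical set forces
    [n >= 2], and [n - 1] is written [k.+1] throughout. *)

(** * Sets of measure zero for an integral exponent *)

Lemma ler_sum_uniq (R : realType) (I : eqType) (F : I -> R) (s t : seq I) :
  (forall i, 0 <= F i) -> uniq s -> uniq t -> {subset s <= t} ->
  \sum_(i <- s) F i <= \sum_(i <- t) F i.
Proof.
move=> F0 us ut st.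
rewrite [leRHS](bigID (mem s)) /= -[X in _ <= X + _]big_filter.
have ps : perm_eq [seq i <- t | i \in s] s.
  apply: uniq_perm => //; first exact: filter_uniq.
  by move=> i; rewrite mem_filter; case: (boolP (i \in s)) => // /st.
by rewrite (perm_big _ ps) lerDl sumr_ge0.
Qed.

Lemma sum_halves_le (R : realType) (e : R) (N : nat) :
  0 <= e -> \sum_(i < N) e / 2 ^+ i.+1 <= e.
Proof.
move=> e0; suff -> : \sum_(i < N) e / 2 ^+ i.+1 = e - e / 2 ^+ N.
  by rewrite gerBl divr_ge0// exprn_ge0.
elim: N => [|N IH]; first by rewrite big_ord0 expr0 divr1 subrr.
rewrite big_ord_recr /= IH.
have -> : e / 2 ^+ N.+1 = (e / 2 ^+ N) / 2 by rewrite exprSr invfM mulrA mulrAC.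
lra.
Qed.

(** A double series bounded row by row by [e / 2], [e / 4], ... stays below [e]
    when it is enumerated along the countable type [nat * nat]. *)
Lemma sum_pickle_le (R : realType) (F : nat * nat -> R) (e : R) :
  0 <= e -> (forall x, 0 <= F x) ->
  (forall i N, \sum_(j < N) F (i, j : nat) <= e / 2 ^+ i.+1) ->
  forall N, \sum_(n < N) oapp F 0 (pickle_inv n) <= e.
Proof.
move=> e0 F0 Fe N; rewrite -(big_mkord xpredT (fun n => oapp F 0 (pickle_inv n))).
rewrite /index_iota subn0; set s := iota 0 N.
have -> : \sum_(n <- s) oapp F 0 (pickle_inv n) = \sum_(x <- pmap pickle_inv s) F x.
  elim: s => [|n s IH]; first by rewrite !big_nil.
  rewrite big_cons IH /=; case: (pickle_inv n) => [x|] /=; first by rewrite big_cons.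
  by rewrite add0r.
have [B HB] : exists B, forall x, x \in pmap (@pickle_inv (nat * nat)%type) s ->
    (x.1 < B)%N /\ (x.2 < B)%N.
  elim: (pmap _ _) => [|x t [B IH]]; first by exists 0%N.
  exists (maxn B (maxn x.1.+1 x.2.+1)) => y; rewrite inE => /orP[/eqP ->|/IH [h1 h2]].
    by rewrite !leq_max !ltnSn !orbT.
  by rewrite !leq_max h1 h2.
apply: (@le_trans _ _ (\sum_(x <- [seq (i, j) | i <- iota 0 B, j <- iota 0 B]) F x)).
  apply: ler_sum_uniq => //.
  - apply: (@pmap_uniq _ _ _ pickle); first exact: pickle_invK.
    exact: iota_uniq.
  - by apply: allpairs_uniq; rewrite ?iota_uniq// => -[? ?] [? ?].
  - move=> x /HB [h1 h2]; apply/allpairsP; exists x.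
    by rewrite !mem_iota h1 h2; case: x {h1 h2}.
rewrite big_allpairs -{1}[B]subn0 -/(index_iota 0 B) big_mkord.
apply: le_trans (sum_halves_le B e0); apply: ler_sum => i _.
by rewrite -{1}[B]subn0 -/(index_iota 0 B) big_mkord.
Qed.

Section null_sets.
Variables (R : realType) (k : nat).

(** This is nullity for the spherical Hausdorff measure of exponent [k.+1].
    Sizes of the covering balls need no separate bound: a small sum already
    makes each radius small.  Radius 0 stands for an unused ball. *)
Definition null_set (V : normedModType R) (E : set V) :=
  forall e : R, 0 < e -> exists (c : nat -> V) (r : nat -> R),
    [/\ forall i, 0 <= r i, E `<=` \bigcup_i ball (c i) (r i) &
        forall N, \sum_(i < N) r i ^+ k.+1 <= e].

Lemma null_set_sub (V : normedModType R) (E F : set V) :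
  E `<=` F -> null_set F -> null_set E.
Proof.
by move=> EF nF e /nF [c [r [r0 Fc re]]]; exists c, r; split=> // x /EF /Fc.
Qed.

Lemma null_set_bigcup (V : normedModType R) (E : nat -> set V) :
  (forall i, null_set (E i)) -> null_set (\bigcup_i E i).
Proof.
move=> nE e e0.
have He i : 0 < e / 2 ^+ i.+1 by rewrite divr_gt0// exprn_gt0.
have /choice[c /choice[r Hr]] i := nE i _ (He i).
exists (fun n => oapp (fun x => c x.1 x.2) 0 (pickle_inv n)).
exists (fun n => oapp (fun x => r x.1 x.2) 0 (pickle_inv n)); split.
- by move=> n; case: pickle_inv => //= x; have [+ _ _] := Hr x.1; apply.
- move=> x [i _ Eix]; have [_ /(_ _ Eix) [j _ xij] _] := Hr i.
  by exists (pickle (i, j)) => //=; rewrite pickleK_inv.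
- move=> N; rewrite (eq_bigr (fun n : 'I_N =>
      oapp (fun x => r x.1 x.2 ^+ k.+1) 0 (pickle_inv n))); last first.
    by move=> n _; case: pickle_inv => //=; rewrite expr0n.
  apply: (@sum_pickle_le _ (fun x => r x.1 x.2 ^+ k.+1)); first exact: ltW.
    by move=> x; apply: exprn_ge0; have [+ _ _] := Hr x.1; apply.
  by move=> i M; have [_ _] := Hr i; apply.
Qed.

(** A Lipschitz estimate at scales below [d] is enough, because the covering
    balls can be taken smaller than [d].  This weak form is what pieces of the
    domain of a differentiable map satisfy. *)
Lemma null_set_image (V W : normedModType R) (g : V -> W) (E : set V) (K d : R) :
  0 < d -> 0 <= K ->
  (forall x y, E x -> E y -> `|y - x| < d -> `|g y - g x| <= K * `|y - x|) ->
  null_set E -> null_set (g @` E).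
Proof.
move=> d0 K0 gK nE e e0.
pose C := 2 * K + 1; have C0 : 0 < C by rewrite /C; lra.
pose e' := Num.min (e / C ^+ k.+1) ((d / 3) ^+ k.+1).
have e'0 : 0 < e'.
  by rewrite lt_min divr_gt0 ?exprn_gt0// ?divr_gt0.
have [c [r [r0 Ec re]]] := nE _ e'0.
(* Two points of a covering ball are at distance less than [2 * d / 3]. *)
have rd i : r i <= d / 3.
  have : r i ^+ k.+1 <= (d / 3) ^+ k.+1.
    apply: le_trans (_ : e' <= _); last by rewrite ge_min lexx orbT.
    apply: le_trans (re i.+1); rewrite big_ord_recr /= lerDr.
    by apply: sumr_ge0 => j _; apply: exprn_ge0.
  by rewrite ler_pXn2r// nnegrE// divr_ge0// ltW.
(* The balls of the image are centred at images of points of [E], as [g] is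
   controlled on [E] only; this costs a factor 2 in the radius. *)
have /choice[x Hx] i : exists x, (exists y, E y /\ ball (c i) (r i) y) ->
    E x /\ ball (c i) (r i) x.
  by have [[y Hy]|] := pselect (exists y, E y /\ ball (c i) (r i) y);
    [exists y|exists 0].
exists (g \o x), (fun i => C * r i); split.
- by move=> i; rewrite mulr_ge0// ltW.
- move=> _ [y Ey <-]; have [i _ yi] := Ec _ Ey.
  have [Ex xi] := Hx i (ex_intro _ y (conj Ey yi)).
  exists i => //; rewrite -ball_normE /= distrC.
  move: xi yi; rewrite -!ball_normE /= => xi yi.
  have xy : `|y - x i| < 2 * r i.
    have := ler_distD (c i) y (x i); rewrite [X in _ <= X + _]distrC; lra.
  have ri : 0 < r i by apply: le_lt_trans xi.
  have xyd : `|y - x i| < d by have := rd i; lra.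
  apply: le_lt_trans (gK _ _ Ex Ey xyd) _.
  apply: (@le_lt_trans _ _ (K * (2 * r i))); first by rewrite ler_wpM2l// ltW.
  by rewrite mulrA (mulrC K) ltr_pM2r// /C ltrDl.
- move=> N; under eq_bigr do rewrite exprMn.
  rewrite -mulr_sumr mulrC -ler_pdivlMr ?exprn_gt0//.
  by apply: le_trans (re N) _; rewrite ge_min lexx.
Qed.

End null_sets.

Section row_vectors.
Variables (R : realType) (n : nat).
Implicit Types v : 'rV[R]_n.

Lemma rV_norm_coord v i : `|v 0 i| <= `|v|.
Proof.
rewrite [leRHS]/Num.norm /= mx_normrE; apply/bigmax_geP; right => /=.
by exists (0, i).
Qed.

Lemma rV_norm_le v (e : R) : 0 <= e -> (forall i, `|v 0 i| <= e) -> `|v| <= e.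
Proof.
move=> e0 ve; rewrite /Num.norm /= mx_normrE; apply/bigmax_leP; split=> // -[i j] _ /=.
by rewrite ord1.
Qed.

Lemma rV_norm_le_euclidean v w : `|v - w| <= euclidean_dist v w.
Proof.
apply: rV_norm_le; first exact: sqrtr_ge0.
move=> i; rewrite !mxE -sqrtr_sqr ler_sqrt; last by apply: sumr_ge0 => j _; apply: sqr_ge0.
by rewrite (bigD1 i) //= lerDl sumr_ge0// => j _; apply: sqr_ge0.
Qed.

Lemma euclidean_dist_le_diameter (A : set 'rV[R]_n) v w :
  A v -> A w -> ((euclidean_dist v w)%:E <= diameter A)%E.
Proof. by move=> Av Aw; apply: ereal_sup_ubound; exists v => //; exists w. Qed.

(** Covers by sets of diameter at most 1 suffice, for then the power [k.+1] of a
    diameter is at most its power [s].  A set of diameter [d] goes into an open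
    ball of radius [2 * max d h]; the small [h] takes care of sets reduced to a
    point. *)
Lemma null_set_hausdorff (k : nat) (s : R) (A : set 'rV[R]_n) :
  0 < s -> s <= k.+1%:R -> hausdorff_measure s A = 0%E -> null_set k A.
Proof.
move=> s0 sk A0 e e0.
pose C : R := 2 ^+ k.+1; have C0 : 0 < C by apply: exprn_gt0.
pose e' := e / C / 2; have e'0 : 0 < e' by rewrite !divr_gt0.
have : (hausdorff_content s 1 A < e'%:E)%E.
  apply: (@le_lt_trans _ _ 0%E); last by rewrite lte_fin.
  by rewrite -A0; apply: ereal_sup_ubound; exists 1 => //=.
move=> /ereal_inf_lt [_ [U [AU Ud] <-] Ue].
pose D i := fine (diameter (U i)).
have Ddef i : U i !=set0 -> diameter (U i) = (D i)%:E /\ 0 <= D i <= 1.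
  move=> [x Ux]; have d0 : (0 <= diameter (U i))%E.
    apply: le_trans (euclidean_dist_le_diameter Ux Ux).
    by rewrite lee_fin sqrtr_ge0.
  have dE : diameter (U i) = (D i)%:E.
    rewrite fineK// ge0_fin_numE//.
    by apply: le_lt_trans (Ud i) _; rewrite ltry.
  by split => //; move: d0 (Ud i); rewrite dE !lee_fin => -> ->.
have Hsum N : \sum_(i < N | U i != set0) D i ^+ k.+1 <= e'.
  rewrite -lee_fin -sumEFin; apply/ltW; apply: le_lt_trans Ue.
  rewrite -(big_mkord (fun i => U i != set0) (fun i => (D i ^+ k.+1)%:E)).
  apply: (@le_trans _ _ (\sum_(0 <= i < N | U i != set0) poweR (diameter (U i)) s)%E).
    apply: lee_sum => i /set0P /Ddef [-> /andP[d0 d1]].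
    rewrite poweR_EFin lee_fin -powR_mulrn//.
    have [->|dn0] := eqVneq (D i) 0; first by rewrite !powR0// ?gt_eqF.
    by apply: ger_powR => //; rewrite d1 andbT lt_neqAle eq_sym dn0.
  by apply: nneseries_lim_ge => i _ _; apply: poweR_ge0.
pose h i := Num.min 1 (e' / 2 ^+ i.+1).
have h0 i : 0 < h i by rewrite lt_min ltr01 divr_gt0 ?exprn_gt0.
have hk i : h i ^+ k.+1 <= e' / 2 ^+ i.+1.
  apply: (@le_trans _ _ (h i)); last by rewrite ge_min lexx orbT.
  by apply: ler_iXnr => //; rewrite ?(ltW (h0 _))// ge_min lexx.
have /choice[c Hc] i : exists x, U i !=set0 -> U i x.
  by have [[x Ux]|?] := pselect (U i !=set0); [exists x|exists 0].
pose r i := if U i != set0 then 2 * Num.max (D i) (h i) else 0.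
have m0 i : 0 < Num.max (D i) (h i) by rewrite lt_max h0 orbT.
exists c, r; split.
- by move=> i; rewrite /r; case: ifP => // _; rewrite mulr_ge0// ltW.
- move=> x /AU [i _ Uix]; exists i => //.
  have U0 : U i !=set0 by exists x.
  rewrite /r ifT; last exact/set0P.
  rewrite -ball_normE /=; apply: le_lt_trans (rV_norm_le_euclidean _ _) _.
  have := euclidean_dist_le_diameter (Hc _ U0) Uix.
  have [-> _] := Ddef _ U0; rewrite lee_fin => /le_lt_trans; apply.
  apply: (@le_lt_trans _ _ (Num.max (D i) (h i))); first by rewrite le_max lexx.
  by have := m0 i; lra.
- move=> N.
  apply: (@le_trans _ _ (C * (\sum_(i < N | U i != set0) D i ^+ k.+1 +
      \sum_(i < N) e' / 2 ^+ i.+1))).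
    rewrite [X in _ * (X + _)]big_mkcond /= -big_split /= mulr_sumr; apply: ler_sum => i _.
    rewrite /r; case: ifPn => [/set0P U0|_]; last first.
      by rewrite expr0n /= add0r mulr_ge0 ?ltW// divr_gt0// exprn_gt0.
    rewrite exprMn ler_pM2l//; have [_ /andP[d0 _]] := Ddef _ U0.
    have [_|_] := leP (D i) (h i).
      by apply: le_trans (hk i) _; rewrite lerDr exprn_ge0.
    by rewrite lerDl divr_ge0 ?exprn_ge0 ?ltW.
  have := Hsum N; have := sum_halves_le N (ltW e'0).
  rewrite mulrC -ler_pdivlMr// => *.
  have -> : e / C = e' + e' by rewrite /e'; lra.
  exact: lerD.
Qed.

End row_vectors.

(** * Balls are not null *)

Lemma card_ord_spread (R : realType) (L : nat) (l : R) (A : {set 'I_L}) :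
  0 <= l -> (forall i j, i \in A -> j \in A -> (i%:R <= j%:R + l)) ->
  #|A|%:R <= l + 1.
Proof.
move=> l0 Al; have [->|[j0 Aj0]] := set_0Vmem A; first by rewrite cards0 addr_ge0.
have [j Aj jmin] := @arg_minnP _ j0 (mem A) (fun i => i) Aj0.
have : (#|A| <= (Num.truncn l).+1)%N.
  rewrite cardE -(size_map (fun i : 'I_L => (i - j)%N)) -[leqRHS](size_iota 0).
  apply: uniq_leq_size.
    rewrite map_inj_in_uniq ?enum_uniq// => a b; rewrite !mem_enum => Aa Ab h.
    apply: val_inj => /=.
    by rewrite -(subnK (jmin _ Aa)) -(subnK (jmin _ Ab)) h.
  move=> _ /mapP[a + ->]; rewrite mem_enum mem_iota /= add0n => Aa.
  rewrite ltnS truncn_ge_nat// natrB ?jmin// lerBlDl; exact: Al.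
move=> h; apply: (@le_trans _ _ (Num.truncn l).+1%:R); first by rewrite ler_nat.
by rewrite -natr1 lerD2r; have /andP[] := truncn_itv l0.
Qed.

Section ball_not_null.
Variables (R : realType) (k : nat).
Local Notation n := k.+1.

Definition grid_point (c : 'rV[R]_n) (rho : R) (L : nat)
    (g : {ffun 'I_n -> 'I_L}) : 'rV[R]_n :=
  \row_j (c 0 j + rho * ((g j)%:R / L%:R)).

(** The condition [rho <= r * L] says that the mesh of the grid is below the
    radius.  Without it the [+ 1] in the number of grid points on an interval
    could not be absorbed by the constant 3. *)
Lemma card_grid_ball (c b : 'rV[R]_n) (rho r : R) (L : nat) :
  0 < rho -> 0 <= r -> (0 < L)%N -> (0 < r -> rho <= r * L%:R) ->
  #|[set g : {ffun 'I_n -> 'I_L} | `|b - grid_point c rho g| < r]%SET|%:R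
    <= (3 * r * L%:R / rho) ^+ n.
Proof.
move=> rho0; rewrite le_eqVlt => /predU1P[<- _ _|r0 L0 /(_ r0) rL].
  rewrite eq_card0 ?mulr0 ?mul0r ?expr0n// => g.
  by rewrite !inE ltNge normr_ge0.
have LR : 0 < L%:R :> R by rewrite ltr0n.
pose T (j : 'I_n) : pred 'I_L :=
  [pred a : 'I_L | `|b 0 j - (c 0 j + rho * (a%:R / L%:R))| < r].
pose l := 2 * r * L%:R / rho.
have l2 : 2 <= l by rewrite ler_pdivlMr// -mulrA ler_pM2l.
have Tl j : #|T j|%:R <= 3 * r * L%:R / rho.
  apply: (@le_trans _ _ (l + 1)); last first.
    have -> : 3 * r * L%:R / rho = 3 / 2 * l by rewrite /l; lra.
    by lra.
  rewrite -cardsE; apply: card_ord_spread; first by lra.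
  move=> i i'; rewrite !inE => hi hi'.
  suff : rho * (i%:R / L%:R) <= rho * (i'%:R / L%:R) + 2 * r.
    move=> /(ler_wpM2l (ltW (divr_gt0 LR rho0))).
    have rn0 := lt0r_neq0 rho0; have Ln0 := lt0r_neq0 LR.
    have -> : L%:R / rho * (rho * (i%:R / L%:R)) = i%:R :> R.
      by field; apply/andP.
    have -> : L%:R / rho * (rho * (i'%:R / L%:R) + 2 * r) = i'%:R + l.
      by rewrite /l; field; apply/andP.
    by [].
  by move: hi hi'; rewrite !ltr_norml => /andP[? ?] /andP[? ?]; lra.
apply: (@le_trans _ _ (\prod_(j < n) #|T j|)%:R).
  have <- : foldr muln 1%N [seq #|T j| | j : 'I_n] = (\prod_(j < n) #|T j|)%N.
    by rewrite foldrE big_image.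
  rewrite ler_nat -(card_family T); apply: subset_leq_card.
  apply/fintype.subsetP => g; rewrite inE => gr; apply/familyP => j; rewrite inE.
  by apply: le_lt_trans gr; have := rV_norm_coord (b - grid_point c rho g) j; rewrite !mxE.
rewrite natr_prod; apply: (@le_trans _ _ (\prod_(j < n) (3 * r * L%:R / rho))).
  by apply: ler_prod => j _; rewrite ler0n Tl.
by rewrite prodr_const card_ord.
Qed.

(** By compactness finitely many balls cover.  Of the [L ^ n] points of a grid of
    mesh [q / L], a ball of radius [r] contains at most [(3 * r * L / q) ^ n] as
    soon as [L] is large, so the sum of the [r ^ n] is at least [(q / 3) ^ n]. *)
Lemma ball_not_null (c : 'rV[R]_n) (rho : R) : 0 < rho -> ~ null_set k (ball c rho).
Proof.
move=> rho0 nB; pose q := rho / 2; have q0 : 0 < q by rewrite divr_gt0.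
pose e := (q / 3) ^+ n / 2; have e0 : 0 < e by rewrite !(divr_gt0,exprn_gt0).
have [b [r [r0 Bb re]]] := nB _ e0.
have Qco : compact (closed_ball c q).
  apply: bounded_closed_compact; last exact: closed_ball_closed.
  exists (`|c| + q); split; first exact: num_real.
  move=> M hM x; rewrite closed_ballE// /closed_ball_ /= => cx.
  by have := ler_distD c x 0; rewrite !subr0 distrC; lra.
move: Qco; rewrite compact_cover => /(_ nat setT (fun i => ball (b i) (r i))).
case=> [i _|x Qx|D _ QD]; first exact: ball_open.
  have /Bb [i _ xi] : ball c rho x by apply: subset_closure_half Qx.
  by exists i.
have /finite_seqP[s Ds] := finite_fset D; rewrite Ds in QD.
have [N DN] : exists N, forall i, i \in s -> (i < N)%N.
  by exists (\max_(i <- s) i.+1)%N => i si; exact: (@leq_bigmax_seq _ s xpredT S).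
pose L := (\max_(i < N) (Num.truncn (q / r i)).+1).+1.
have L0 : (0 < L)%N by [].
have Lr i : (i < N)%N -> 0 < r i -> q <= r i * L%:R.
  move=> iN ri; rewrite mulrC -ler_pdivrMr//.
  apply: le_trans (ltW (truncnS_gt _)) _; rewrite ler_nat.
  by apply: leqW; exact: (@leq_bigmax _ (fun i : 'I_N => (Num.truncn (q / r i)).+1) (Ordinal iN)).
have LR : 0 < L%:R :> R by rewrite ltr0n.
pose S (i : 'I_N) := [set g : {ffun 'I_n -> 'I_L} | `|b i - grid_point c q g| < r i]%SET.
have cov (g : {ffun 'I_n -> 'I_L}) : exists i : 'I_N, g \in S i.
  have /QD [i /= iD] : closed_ball c q (grid_point c q g).
    rewrite closed_ballE// /closed_ball_ /= rV_norm_le ?ltW// => j.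
    rewrite !mxE opprD addrA subrr sub0r normrN normrM gtr0_norm//.
    rewrite ger0_norm ?divr_ge0// -[leRHS]mulr1 ler_pM2l// ler_pdivrMr// mul1r ler_nat.
    exact: ltnW.
  by rewrite -ball_normE /= => gi; exists (Ordinal (DN _ iD)); rewrite inE.
have : (L ^ n <= \sum_(i < N) #|S i|)%N.
  have -> : (L ^ n)%N = #|{: {ffun 'I_n -> 'I_L}}| by rewrite card_ffun !card_ord.
  rewrite -sum1_card; under [leqRHS]eq_bigr => i _ do rewrite -sum1_card big_mkcond /=.
  rewrite exchange_big /=; apply: leq_sum => g _.
  by have [i gi] := cov g; rewrite (bigD1 i) //= gi.
apply/negP; rewrite -ltnNge -(ltr_nat R) natr_sum natrX.
apply: (@le_lt_trans _ _ (\sum_(i < N) (3 * r i * L%:R / q) ^+ n)).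
  by apply: ler_sum => i _; apply: card_grid_ball => //; apply: Lr.
have -> : \sum_(i < N) (3 * r i * L%:R / q) ^+ n =
    (L%:R ^+ n / (q / 3) ^+ n) * \sum_(i < N) r i ^+ n.
  rewrite mulr_sumr; apply: eq_bigr => i _.
  rewrite -expr_div_n -exprMn.
  have -> : 3 * r i * L%:R / q = L%:R / (q / 3) * r i by field; rewrite gt_eqF.
  by [].
have A0 : 0 < (q / 3) ^+ n by rewrite exprn_gt0// divr_gt0.
apply: (@le_lt_trans _ _ (L%:R ^+ n / (q / 3) ^+ n * e)).
  by apply: ler_wpM2l (re N); rewrite divr_ge0 ?exprn_ge0// ?divr_ge0 ?ltW.
rewrite /e mulrA divfK ?gt_eqF//.
by have : 0 < L%:R ^+ n :> R; [exact: exprn_gt0|lra].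
Qed.

End ball_not_null.

(** * Null sets of exponent n - 1 do not separate balls *)

Lemma segment_cross (R : realType) (V : normedModType R) (A B Q : set V) (a b : V) :
  open A -> open B -> A `&` B `&` Q = set0 -> A a -> B b ->
  (forall t : R, 0 <= t <= 1 -> Q (a + t *: (b - a))) ->
  exists t : R, (Q `\` (A `|` B)) (a + t *: (b - a)).
Proof.
move=> oA oB AB0 Aa Bb Qab; apply: contrapT => hE.
pose g (t : R) := a + t *: (b - a).
have cg : continuous g.
  by move=> t; apply: cvgD; [exact: cvg_cst|exact: scalel_continuous].
have AB t : 0 <= t <= 1 -> A (g t) \/ B (g t).
  move=> t01; apply: contrapT => nAB; apply: hE; exists t.
  by split; [exact: Qab|move=> ?; apply: nAB].
have notAB t : 0 <= t <= 1 -> A (g t) -> B (g t) -> False.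
  move=> t01 At Bt; have : (A `&` B `&` Q) (g t) by split => //; apply: Qab.
  by rewrite AB0.
have H1 : `[0, 1]%classic `&` g @^-1` A = `[0, 1]%classic.
  apply: (@segment_connected R 0 1).
  - by exists 0; split; rewrite /= ?in_itv /= ?lexx ?ler01// /g scale0r addr0.
  - by exists (g @^-1` A) => //; apply: open_comp => // t _; apply: cg.
  - exists (~` (g @^-1` B)).
      by apply: open_closedC; apply: open_comp => // t _; apply: cg.
    apply/seteqP; split=> t [] /=; rewrite in_itv /= => t01 h; split=> //.
      by move=> Bt; apply: (notAB t).
    by have [] := AB t t01.
have : (`[0, 1]%classic : set R) 1 by rewrite /= in_itv /= ler01 lexx.
rewrite -H1 => -[_ /= A1]; apply: (notAB 1) => //; first by rewrite ler01 lexx.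
by rewrite /g scale1r addrC subrK.
Qed.

Lemma ball_segment (R : realType) (V : normedModType R) (z a b : V) (r t : R) :
  ball z r a -> ball z r b -> 0 <= t <= 1 -> ball z r (a + t *: (b - a)).
Proof.
rewrite -ball_normE /= => za zb /andP[t0 t1].
have -> : z - (a + t *: (b - a)) = (1 - t) *: (z - a) + t *: (z - b).
  rewrite scalerBl scale1r -addrA -scalerN -scalerDr.
  have -> : - (z - a) + (z - b) = - (b - a) by rewrite !opprB addrA subrK.
  by rewrite scalerN opprD addrA.
apply: le_lt_trans (ler_normD _ _) _; rewrite !normrZ (ger0_norm t0) ger0_norm ?subr_ge0//.
have [->|tn0] := eqVneq t 0; first by rewrite mul0r addr0 subr0 mul1r.
have tp : 0 < t by rewrite lt_neqAle eq_sym tn0.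
apply: (@lt_le_trans _ _ ((1 - t) * r + t * r)); last by rewrite -mulrDl subrK mul1r.
by rewrite ler_ltD ?ltr_pM2l// ler_wpM2l ?subr_ge0// ltW.
Qed.

(** With [x] in [A] and [y] in [B], [p] is the projection of kernel [y - x] onto
    the coordinates other than one, [i0], where [x] and [y] differ.  If [A] and
    [B] contain the balls of radius [r] around [x] and [y], every line of
    direction [y - x] whose projection is within [r] of [p x] goes from [A] to
    [B], so it meets the exceptional set; hence the image of that set by [p]
    contains a ball of one dimension less. *)
Lemma null_set_nonseparating (R : realType) (k : nat) (z : 'rV[R]_k.+2) (rho : R)
    (A B : set 'rV[R]_k.+2) :
  open A -> open B -> A `&` B `&` ball z rho = set0 ->
  A `&` ball z rho !=set0 -> B `&` ball z rho !=set0 ->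
  ~ null_set k (ball z rho `\` (A `|` B)).
Proof.
move=> oA oB AB0 [x [Ax Qx]] [y [By Qy]] nE.
have oAQ : open (A `&` ball z rho) by apply: openI => //; apply: ball_open.
have oBQ : open (B `&` ball z rho) by apply: openI => //; apply: ball_open.
have [r r0 [xr yr]] : exists2 r : R, 0 < r &
    ball x r `<=` A `&` ball z rho /\ ball y r `<=` B `&` ball z rho.
  have /nbhs_ballP[r1 /= r10 h1] : nbhs x (A `&` ball z rho) by apply: open_nbhs_nbhs.
  have /nbhs_ballP[r2 /= r20 h2] : nbhs y (B `&` ball z rho) by apply: open_nbhs_nbhs.
  exists (Num.min r1 r2); first by rewrite lt_min r10.
  by split; [apply: subset_trans h1|apply: subset_trans h2];
    apply: le_ball; rewrite ge_min lexx ?orbT.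
have [i0 xy0] : exists i0, y 0 i0 - x 0 i0 != 0.
  apply: contrapT => /forallNP h; have xy : x = y.
    apply/rowP => i; apply/esym/eqP; rewrite -subr_eq0.
    by apply/negPn/negP; exact: h.
  by rewrite -xy in By; have : (A `&` B `&` ball z rho) x by []; rewrite AB0.
pose s (j : 'I_k.+1) := (y 0 (lift i0 j) - x 0 (lift i0 j)) / (y 0 i0 - x 0 i0).
pose p (u : 'rV[R]_k.+2) : 'rV[R]_k.+1 := \row_j (u 0 (lift i0 j) - s j * u 0 i0).
pose emb (v : 'rV[R]_k.+1) : 'rV[R]_k.+2 :=
  \row_i (if unlift i0 i is Some j then v 0 j else 0).
have emb_norm v : `|emb v| <= `|v|.
  apply: rV_norm_le => // i; rewrite mxE; case: unlift => [j|]; last by rewrite normr0.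
  exact: rV_norm_coord.
have pE v t : p (x + emb v + t *: (y + emb v - (x + emb v))) = p x + v.
  apply/rowP => j; rewrite !mxE liftK unlift_none.
  rewrite /s; field; exact: xy0.
have : null_set k (p @` (ball z rho `\` (A `|` B))).
  apply: (@null_set_image _ _ _ _ _ _ (1 + \sum_j `|s j|) 1) => //.
    by rewrite addr_ge0// sumr_ge0.
  move=> u w _ _ _; apply: rV_norm_le.
    by rewrite mulr_ge0// addr_ge0// sumr_ge0.
  move=> j; rewrite !mxE.
  have -> : w 0 (lift i0 j) - s j * w 0 i0 - (u 0 (lift i0 j) - s j * u 0 i0) =
    (w - u) 0 (lift i0 j) - s j * (w - u) 0 i0 by rewrite !mxE; ring.
  apply: le_trans (ler_normB _ _) _; rewrite normrM mulrDl mul1r.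
  apply: lerD; first exact: rV_norm_coord.
  apply: ler_pM => //; last exact: rV_norm_coord.
  by rewrite (bigD1 j) //= lerDl sumr_ge0.
move=> nP; apply: (@ball_not_null _ _ (p x) _ r0); apply: null_set_sub nP.
move=> w; rewrite -ball_normE /= => wr; set v := w - p x.
have vr : `|emb v| < r by apply: le_lt_trans (emb_norm _) _; rewrite /v distrC.
have [Axv Qxv] : (A `&` ball z rho) (x + emb v).
  by apply: xr; rewrite -ball_normE /= opprD addrA subrr sub0r normrN.
have [Byv Qyv] : (B `&` ball z rho) (y + emb v).
  by apply: yr; rewrite -ball_normE /= opprD addrA subrr sub0r normrN.
have [t Et] := segment_cross oA oB AB0 Axv Byv (fun t => ball_segment Qxv Qyv).
by exists (x + emb v + t *: (y + emb v - (x + emb v))) => //; rewrite pE /v addrC subrK.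
Qed.

(** * Openness of submersions *)

Lemma mean_value_coord (R : realType) (m n : nat) (g : 'rV[R]_m -> 'rV[R]_n)
    (y w : 'rV[R]_m) (j : 'I_n) :
  (forall t : R, 0 <= t <= 1 -> differentiable g (y + t *: w)) ->
  exists2 t : R, 0 <= t <= 1 & g (y + w) 0 j - g y 0 j = ('d g (y + t *: w) w) 0 j.
Proof.
move=> dg; pose F (t : R) : R := g (y + t *: w) 0 j.
have dF (t : R) : 0 <= t <= 1 -> is_derive t 1 F (('d g (y + t *: w) w) 0 j).
  move=> t01.
  have dline : is_diff t (fun s : R => y + s *: w) (fun s : R => s *: w).
    have := is_diffD (is_diff_cst y t) (is_diff_scalel t w).
    by rewrite add0r.
  have dgt := differentiableP (dg t t01).
  have dgline := @is_diff_comp R _ _ _ _ _ _ _ _ dline dgt.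
  have dcoord (v : 'rV[R]_n) : is_diff v (fun u : 'rV[R]_n => u 0 j : R) (fun u => u 0 j).
    have lin : linear (fun u : 'rV[R]_n => u 0 j : R) by move=> a u u'; rewrite !mxE.
    pose linM := GRing.isLinear.Build _ _ _ _ _ lin.
    pose linL : {linear _ -> _} := HB.pack (fun u : 'rV[R]_n => u 0 j : R) linM.
    apply: DiffDef; first exact: differentiable_coord.
    by rewrite (@diff_lin _ _ _ linL)//; exact: coord_continuous.
  have dFt := @is_diff_comp R _ _ _ _ _ _ _ _ dgline (dcoord _).
  apply: DeriveDef; first exact: diff_derivable.
  by rewrite deriveE// (@diff_val _ _ _ _ _ _ _ dFt) /= scale1r.
have cF : {within `[0, 1], continuous F}.
  apply: derivable_within_continuous => t; rewrite in_itv /= => t01.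
  by have [] := dF t t01.
have [||t] := @MVT_segment R F (fun t => ('d g (y + t *: w) w) 0 j) 0 1 _ _ cF => //.
  by move=> t; rewrite in_itv /= => /andP[/ltW t0 /ltW t1]; apply: dF; rewrite t0.
by rewrite in_itv /= => t01; rewrite /F scale1r scale0r addr0 subr0 mulr1 => h; exists t.
Qed.

(** If [c] minimizes the distance from [h c] to [w], the Newton step
    [c - (h c - w)] at least halves this distance, so it is 0.  The bound
    [rho / 8] keeps [c] within [rho / 2] of the centre and the step inside the
    ball. *)
Lemma near_identity_surjective (R : realType) (n : nat) (h : 'rV[R]_n -> 'rV[R]_n)
    (rho : R) :
  0 < rho ->
  (forall u v, `|u| <= rho -> `|v| <= rho -> `|h v - h u - (v - u)| <= 2^-1 * `|v - u|) ->
  forall w, `|w - h 0| < rho / 8 -> exists2 u, `|u| <= rho & h u = w.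
Proof.
move=> rho0 hid w wh.
pose A := [set u : 'rV[R]_n | `|u| <= rho].
have Aco : compact A.
  have -> : A = closed_ball 0 rho.
    by rewrite closed_ballE// /closed_ball_; apply/seteqP; split=> u; rewrite /= sub0r normrN.
  apply: bounded_closed_compact; last exact: closed_ball_closed.
  exists rho; split; first exact: num_real.
  move=> M hM u; rewrite closed_ballE// /closed_ball_ /= sub0r normrN => ur.
  exact: le_trans ur (ltW hM).
have hlip u v : A u -> A v -> `|h u - h v| <= 2 * `|u - v|.
  move=> Au Av; have -> : h u - h v = (h u - h v - (u - v)) + (u - v) by rewrite subrK.
  apply: le_trans (ler_normD _ _) _; have := hid v u Av Au.
  by have := normr_ge0 (u - v); lra.
have cf : {within A, continuous (fun u => `|h u - w|)}.
  apply/subspace_continuousP => u Au; apply/cvgrPdist_lt => e e0.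
  rewrite near_withinE; near=> v => Av.
  apply: le_lt_trans (ler_dist_dist _ _) _.
  rewrite opprB addrA subrK; apply: le_lt_trans (hlip _ _ Au Av) _.
  rewrite mulrC -ltr_pdivlMr//.
  near: v; apply/nbhs_ballP; exists (e / 2); first by rewrite /= divr_gt0.
  by move=> v; rewrite -ball_normE.
have A0 : A !=set0 by exists 0; rewrite /A /= normr0 ltW.
have [c] := EVT_min_rV A0 Aco cf; rewrite inE => Ac cmin.
exists c => //; apply/eqP; rewrite -subr_eq0 -normr_eq0; apply/negPn/negP => d0.
pose d := `|h c - w|; have dp : 0 < d by rewrite lt_neqAle eq_sym d0 normr_ge0.
have dr : d < rho / 8.
  by apply: le_lt_trans wh; rewrite [leRHS]distrC; apply: cmin; rewrite inE /A /= normr0 ltW.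
pose c' := c - (h c - w).
have cr : `|c| <= rho / 2.
  have := hid 0 c; rewrite normr0 subr0 => /(_ (ltW rho0) Ac) h1.
  have : `|c| <= `|h c - h 0 - c| + `|h c - w| + `|w - h 0|.
    have {1}-> : c = - (h c - h 0 - c) + (h c - w) + (w - h 0).
      by rewrite opprB -addrA [h c - w + _]addrA subrK subrK.
    apply: le_trans (ler_normD _ _) _; rewrite lerD2r.
    by apply: le_trans (ler_normD _ _) _; rewrite normrN.
  by move: wh dr; rewrite /d; lra.
have Ac' : `|c'| <= rho.
  by apply: le_trans (ler_normB _ _) _; move: dr; rewrite /d; lra.
have := cmin c'; rewrite inE => /(_ Ac').
apply/negP; rewrite -ltNge -/d.
have c'c : c' - c = - (h c - w) by rewrite /c' addrC addKr.
have -> : h c' - w = h c' - h c - (c' - c).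
  by rewrite c'c opprK addrA subrK.
apply: le_lt_trans (hid _ _ Ac Ac') _.
by rewrite c'c normrN -/d; lra.
Unshelve. all: by end_near. Qed.

(** Composing [g] with a linear right inverse [L] of its differential gives a map
    [h] of [R^n] to itself whose differential is the identity at 0 and stays
    near it around 0, so that the mean value theorem makes [h - id] a
    contraction on a ball. *)
Lemma submersion_nbhs (R : realType) (m n : nat) (D : set 'rV[R]_m)
    (g : 'rV[R]_m -> 'rV[R]_n) (x : 'rV[R]_m) :
  open D -> D x -> Ck_on 1 D g -> (forall w, exists v, 'd g x v = w) ->
  nbhs (g x) (g @` D).
Proof.
move=> oD Dx [dg cg] surj.
have /choice[v vE] i := surj (delta_mx 0 i).
pose L (u : 'rV[R]_n) := \sum_i u 0 i *: v i.
pose C := 1 + \sum_i `|v i|; have C0 : 0 < C by rewrite ltr_pwDl// sumr_ge0.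
have Lnorm u : `|L u| <= C * `|u|.
  apply: le_trans (ler_norm_sum _ _ _) _; rewrite mulrDl mulr_suml mul1r.
  rewrite -[leLHS]add0r; apply: lerD => //; apply: ler_sum => i _.
  by rewrite normrZ mulrC ler_wpM2l// rV_norm_coord.
have LD u u' : L (u + u') = L u + L u'.
  by rewrite /L -big_split /=; apply: eq_bigr => i _; rewrite mxE scalerDl.
have LZ t u : L (t *: u) = t *: L u.
  by rewrite /L scaler_sumr; apply: eq_bigr => i _; rewrite mxE scalerA.
pose e : R := (2 * n.+1%:R)^-1; have e0 : 0 < e by rewrite invr_gt0 mulr_gt0.
have [r r0 rD] : exists2 r, 0 < r & forall z, ball x r z ->
    D z /\ forall i, `|'D_(v i) g z - 'D_(v i) g x| <= e.
  suff /nbhs_ballP[r /= r0 h] : \forall z \near x, D z /\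
    forall i, `|'D_(v i) g z - 'D_(v i) g x| <= e by exists r.
  have Hv : \forall z \near x, forall i, `|'D_(v i) g z - 'D_(v i) g x| <= e.
    apply: (@filter_forall _ _ (fun i z => `|'D_(v i) g z - 'D_(v i) g x| <= e) (nbhs x) _) => i.
    have /cvgrPdist_le /(_ e e0) := cg (v i) x Dx.
    apply: filterS => z /= Hz.
    rewrite -normrN opprB.
    exact: Hz.
  by apply: filterI Hv; apply: open_nbhs_nbhs.
pose h u := g (x + L u).
pose rho := r / (2 * C); have rho0 : 0 < rho by rewrite divr_gt0 ?mulr_gt0.
have Lball u : `|u| <= rho -> ball x r (x + L u).
  rewrite -ball_normE /= opprD addrA subrr sub0r normrN => ur.
  apply: le_lt_trans (Lnorm _) _; apply: (@le_lt_trans _ _ (C * rho)).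
    by rewrite ler_pM2l.
  have -> : C * rho = r / 2 by rewrite /rho; field; rewrite gt_eqF.
  by lra.
have hid u u' : `|u| <= rho -> `|u'| <= rho ->
    `|h u' - h u - (u' - u)| <= 2^-1 * `|u' - u|.
  move=> ur u'r; set d := u' - u.
  have seg t : 0 <= t <= 1 -> ball x r (x + L u + t *: L d).
    move=> t01; have -> : L d = (x + L u') - (x + L u).
      have -> : L u' = L (d + u) by rewrite /d subrK.
      by rewrite (LD d u) opprD addrACA subrr add0r addrK.
    by apply: ball_segment => //; apply: Lball.
  apply: rV_norm_le => [|j]; first by rewrite mulr_ge0 ?invr_ge0.
  have [|t t01 tE] := @mean_value_coord R m n g (x + L u) (L d) j.
    by move=> t /seg /rD[Dz _]; apply: dg.
  have [Dz Hz] := rD _ (seg t t01); move: tE Dz Hz; set z := _ + t *: _ => tE Dz Hz.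
  have -> : (h u' - h u - d) 0 j = \sum_i d 0 i * ('D_(v i) g z - 'D_(v i) g x) 0 j.
    have hu' : h u' = g (x + L u + L d) by rewrite -addrA -(LD u d) (addrC u) /d subrK.
    have dj : d 0 j = \sum_i d 0 i * ('D_(v i) g x) 0 j.
      under eq_bigr => i _ do rewrite (deriveE _ (dg x Dx)) vE [delta_mx _ _ _ _]mxE.
      rewrite (bigD1 j) //= !eqxx mulr1 big1 ?addr0// => i ij.
      by rewrite eq_sym (negbTE ij) mulr0.
    transitivity (h u' 0 j - h u 0 j - d 0 j); first by rewrite !mxE.
    rewrite hu' tE [in X in X - _]/L linear_sum summxE {1}dj.
    rewrite -sumrB; apply: eq_bigr => i _.
    rewrite linearZ /= (deriveE _ (dg z Dz)) !mxE mulrBr.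
    by [].
  apply: le_trans (ler_norm_sum _ _ _) _.
  apply: (@le_trans _ _ (\sum_(i < n) `|d| * e)).
    apply: ler_sum => i _; rewrite normrM; apply: ler_pM => //.
      exact: rV_norm_coord.
    by apply: le_trans (Hz i); apply: rV_norm_coord.
  rewrite sumr_const card_ord -[_ *+ n]mulr_natr -mulrA mulrC ler_wpM2r//.
  rewrite /e invfM -mulrA ger_pMr// mulrC ler_pdivrMr// mul1r ler_nat.
  exact: leqnSn.
have h0 : h 0 = g x by rewrite /h /L big1 ?addr0// => i _; rewrite mxE scale0r.
apply/nbhs_ballP; exists (rho / 8); first by rewrite /= divr_gt0.
move=> w; rewrite -ball_normE /= distrC -h0 => wr.
have [u ur <-] := near_identity_surjective rho0 hid wr.
by exists (x + L u) => //; have [] := rD _ (Lball _ ur).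
Qed.

(** * Null sets and differentiable maps *)

Lemma differentiable_pointwise_lipschitz (R : realType) (V W : normedModType R)
    (g : V -> W) (x : V) :
  differentiable g x ->
  exists K : nat, forall y, `|y - x| < K.+1%:R^-1 -> `|g y - g x| <= K.+1%:R * `|y - x|.
Proof.
move=> dg; have [k k0 kdg] := linear_lipschitz (diff_continuous dg).
have /eqaddoP /(_ 1 ltr01) /nbhs_ballP[d /= d0 Hd] := diff_locally dg.
exists (Num.truncn (k + 1 + d^-1)) => y; set K := _.+1%:R => yx.
have Kk : k + 1 + d^-1 < K by apply: truncnS_gt.
have K0 : 0 < K by rewrite ltr0n.
have di : 0 < d^-1 by rewrite invr_gt0.
have yd : `|y - x| < d.
  apply: lt_trans yx _; rewrite -[d]invrK ltf_pV2 ?posrE//.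
  by apply: lt_trans Kk; lra.
have := Hd (y - x); rewrite -ball_normE /= sub0r normrN => /(_ yd).
rewrite !fctE /= subrK /cst mul1r => h.
have -> : g y - g x = (g y - (g x + 'd g x (y - x))) + 'd g x (y - x).
  by rewrite opprD addrA subrK.
apply: le_trans (ler_normD _ _) _; apply: le_trans (lerD h (kdg _)) _.
rewrite -[X in X + _ <= _]mul1r -mulrDl ler_wpM2r//.
by move: Kk di; lra.
Qed.

(** The points where the Lipschitz estimate holds with constant [K.+1] at scale
    [1 / K.+1] form countably many pieces as [K] varies. *)
Lemma null_set_image_differentiable (R : realType) (k : nat) (V W : normedModType R)
    (g : V -> W) (E : set V) :
  (forall x, E x -> differentiable g x) -> null_set k E -> null_set k (g @` E).
Proof.
move=> dg nE.
pose F (K : nat) := E `&` [set x | forall y, `|y - x| < K.+1%:R^-1 ->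
   `|g y - g x| <= K.+1%:R * `|y - x|].
apply: (@null_set_sub _ _ _ _ (\bigcup_K (g @` F K))).
  move=> _ [x Ex <-]; have [K HK] := differentiable_pointwise_lipschitz (dg _ Ex).
  by exists K => //; exists x.
apply: null_set_bigcup => K.
apply: (@null_set_image _ _ _ _ _ _ K.+1%:R K.+1%:R^-1).
- by rewrite invr_gt0.
- by [].
- by move=> x y [_ Fx] _; apply: Fx.
- by apply: null_set_sub nE => x [].
Qed.

Lemma null_set_countable_bigcup (R : realType) (k : nat) (V : normedModType R)
    (I : Type) (D : set I) (E : I -> set V) :
  countable D -> (forall i, D i -> null_set k (E i)) -> null_set k (\bigcup_(i in D) E i).
Proof.
move=> /pfcard_geP[->|[h]] nE.
  rewrite bigcup_set0 => e e0; exists (fun=> 0), (fun=> 0); split => // N.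
  by rewrite big1 ?ltW// => i _; rewrite expr0n.
rewrite -(image_eq h) bigcup_image; apply: null_set_bigcup => i.
by apply: nE; exact: funS.
Qed.

(** * Charts, tangent vectors and C^1 maps of manifolds *)

Section charts.
Variables (R : realType) (m : nat).

Lemma chart_image_open_subset (T : topologicalType) (a : chart R T m) (A : set T) :
  open A -> open (a @` (chart_dom a `&` A)).
Proof.
move=> oA; rewrite openE => _ [p [ap Ap] <-]; rewrite /interior.
have aap : (a @` chart_dom a) (a p) by exists p.
have nA : nbhs (a p) (chart_inv a @^-1` A).
  apply: chart_inv_continuous => //; rewrite chart_mapK//; exact: open_nbhs_nbhs.
have nD : nbhs (a p) (a @` chart_dom a).
  by apply: open_nbhs_nbhs; split => //; exact: chart_image_open.
apply: filterS (filterI nA nD) => z [/= + [q aq qz]].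
by rewrite -qz chart_mapK// => Aq; exists q.
Qed.

Lemma near_eq_diff (V W : normedModType R) (f g : V -> W) (x v : V) :
  differentiable f x -> differentiable g x -> (\near x, f x = g x) ->
  'd f x v = 'd g x v.
Proof. by move=> df dg fg; rewrite -!deriveE//; exact: near_eq_derive. Qed.

Lemma diff_comp_at (U V W : normedModType R) (f : U -> V) (g : V -> W) (x v : U) (y : V) :
  f x = y -> differentiable f x -> differentiable g y ->
  'd (g \o f) x v = 'd g y ('d f x v).
Proof. by move=> <- df dg; rewrite diff_comp. Qed.

Variables (M : manifold R m) (p : M).

Lemma transition_differentiable (a b : chart_at p) :
  differentiable (b \o chart_inv a) (a p).
Proof.
have [+ _] := atlas_compatible (chart_at_atlas a) (chart_at_atlas b).
move=> /(_ 1%N) [+ _]; apply; exists p => //.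
by split; exact: chart_at_dom.
Qed.

Lemma near_overlap (a b : chart_at p) :
  \forall z \near a p, (a @` (chart_dom a `&` chart_dom b)) z.
Proof.
apply: open_nbhs_nbhs; split.
  by apply: chart_image_open_subset; exact: chart_dom_open.
by exists p => //; split; exact: chart_at_dom.
Qed.

Lemma transition_diff_comp (a b c : chart_at p) v :
  'd (c \o chart_inv a) (a p) v =
    'd (c \o chart_inv b) (b p) ('d (b \o chart_inv a) (a p) v).
Proof.
have bpE : (b \o chart_inv a) (a p) = b p by rewrite /= chart_mapK//; exact: chart_at_dom.
have dba := transition_differentiable a b.
have dcb := transition_differentiable b c.
refine (etrans _ (diff_comp_at v bpE dba dcb)).
apply: near_eq_diff; first exact: transition_differentiable.
  by apply: (differentiable_comp dba); rewrite bpE; exact: dcb.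
apply: filterS (near_overlap a b) => z [q [aq bq] qz] /=.
by rewrite -qz !chart_mapK.
Qed.

Lemma transition_diff_id (a : chart_at p) v : 'd (a \o chart_inv a) (a p) v = v.
Proof.
have did : 'd (fun x : 'rV[R]_m => x) (a p) v = v by rewrite diff_val.
refine (etrans _ did).
apply: near_eq_diff; [exact: transition_differentiable|exact: ex_diff|].
by apply: filterS (near_overlap a a) => z [q [aq _] qz] /=; rewrite -qz chart_mapK.
Qed.

(** A tangent vector is determined by its coordinates in one chart, and by the
    chain rule any coordinates occur; so surjectivity of the abstract
    differential passes to its expression in charts. *)
Lemma tangent_of_coord (a : chart_at p) (v : 'rV[R]_m) : exists w : tangent p, w a = v.
Proof.
pose w (b : chart_at p) := 'd (b \o chart_inv a) (a p) v.
have wP (b c : chart_at p) : w c = 'd (c \o chart_inv b) (b p) (w b).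
  exact: transition_diff_comp.
exists (Tangent wP); exact: transition_diff_id.
Qed.

End charts.

Section C1_maps.
Variables (R : realType) (m n : nat) (M : manifold R m) (N : manifold R n).
Variables (f : M -> N) (f_C1 : C1_map f).

Lemma C1_map_domain_open (a : chart R M m) (b : chart R N n) :
  open (a @` (chart_dom a `&` f @^-1` chart_dom b)).
Proof.
apply: chart_image_open_subset; apply: open_comp; last exact: chart_dom_open.
by move=> x _; case: f_C1 => + _; exact.
Qed.

Lemma regular_point_interior p : regular_point f p -> (range f)° (f p).
Proof.
move=> reg; have [a0 Aa ap] := atlas_cover p; have [b0 Ab bp] := atlas_cover (f p).
pose a := ChartAt Aa ap; pose b := ChartAt Ab bp.
pose D := a0 @` (chart_dom a0 `&` f @^-1` chart_dom b0).
pose g := b0 \o f \o chart_inv a0.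
have gap : g (a0 p) = b0 (f p) by rewrite /g /= chart_mapK.
have : nbhs (g (a0 p)) (g @` D).
  apply: submersion_nbhs.
  - exact: C1_map_domain_open.
  - by exists p.
  - by have [_] := f_C1; apply.
  - move=> v; have [w <-] := tangent_of_coord b v.
    have [u uw] := reg w; exists (u a).
    by rewrite (uw a b).
rewrite gap => gD.
have nb : nbhs (f p) (b0 @^-1` (g @` D)) by apply: chart_map_continuous.
have nd : nbhs (f p) (chart_dom b0).
  by apply: open_nbhs_nbhs; split => //; exact: chart_dom_open.
rewrite /interior; apply: filterS (filterI nb nd) => q [[_ [x [ax bx] <-] gx] bq].
exists x => //; rewrite -(chart_mapK bq) -gx /g /= (chart_mapK ax) chart_mapK//.
Qed.

(** Nullity is given chart by chart, and the atlas need not be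
    countable; a countable basis of the topology yields countably many open
    sets, each inside the domain of a chart, that cover the manifold. *)
Lemma null_set_C1_image (k : nat) (s : R) (C : set M) (b : chart R N n) :
  0 < s -> s <= k.+1%:R -> hausdorff_null s C -> atlas b ->
  null_set k (b @` (f @` C `&` chart_dom b)).
Proof.
move=> s0 sk nC Ab; have [B cB [Bo Bb]] := manifold_second_countable M.
pose D := B `&` [set U | exists2 a : chart R M m, atlas a & U `<=` chart_dom a].
pose E (U : set M) := (b \o f) @` (C `&` U `&` f @^-1` chart_dom b).
apply: (@null_set_sub _ _ _ _ (\bigcup_(U in D) E U)).
  move=> _ [_ [[x Cx <-] bfx] <-].
  have [a Aa ax] := atlas_cover x.
  have /Bb[U [BU Ux] Ua] : nbhs x (chart_dom a).
    by apply: open_nbhs_nbhs; split => //; exact: chart_dom_open.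
  by exists U; [split => //; exists a|exists x].
apply: null_set_countable_bigcup.
  by apply: sub_countable cB; apply: subset_card_le => U [].
move=> U [_ [a Aa Ua]].
pose g := b \o f \o chart_inv a.
pose F := a @` (C `&` chart_dom a) `&` (a @` (chart_dom a `&` f @^-1` chart_dom b)).
apply: (@null_set_sub _ _ _ _ (g @` F)).
  move=> _ [x [[Cx Ux] bx] <-]; have ax := Ua _ Ux.
  by exists (a x); [split; exists x|rewrite /g /= chart_mapK].
apply: null_set_image_differentiable.
  by move=> x [_ Dx]; have [_ /(_ a b Aa Ab) [+ _]] := f_C1; exact.
apply: (@null_set_sub _ _ _ _ (a @` (C `&` chart_dom a))); first by move=> x [].
by apply: null_set_hausdorff s0 sk _; exact: nC.
Qed.

End C1_maps.

(** * The boundary of the image *)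

Lemma dim_subset_lt_null (R : realType) (m n : nat) (M : manifold R m) (E : set M) :
  (dim_subset E < (n%:R - 1)%:E)%E ->
  exists k s, [/\ n = k.+2, 0 < s, s <= k.+1%:R & hausdorff_null s E].
Proof.
move=> /ereal_inf_lt [_ [s [s0 nE] <-]]; rewrite lte_fin => sn.
have : (1 < n)%N by rewrite -(ltr_nat R); lra.
case: n sn => [|[|k]] // sn _; exists k, s; split => //.
by move: sn; rewrite -[k.+2%:R]natr1; lra.
Qed.

(** A point in both closures is approached by both open sets, so that in a small
    ball of a chart around it they would be separated by what they leave out. *)
Lemma null_boundary_chart (R : realType) (k : nat) (N : manifold R k.+2)
    (A B : set N) (q : N) :
  open A -> open B -> A `&` B = set0 -> closure A q -> closure B q ->
  exists2 b : chart R N k.+2, atlas b &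
    ~ null_set k (b @` (~` (A `|` B) `&` chart_dom b)).
Proof.
move=> oA oB AB0 Aq Bq; have [b Ab bq] := atlas_cover q; exists b => //.
have /nbhs_ballP[r /= r0 rD] : nbhs (b q) (b @` chart_dom b).
  by apply: open_nbhs_nbhs; split; [exact: chart_image_open|exists q].
have nq : nbhs q (chart_dom b `&` b @^-1` ball (b q) r).
  apply: filterI; first by apply: open_nbhs_nbhs; split => //; exact: chart_dom_open.
  by apply: chart_map_continuous => //; exact: nbhsx_ballx.
have meets C : closure C q -> b @` (chart_dom b `&` C) `&` ball (b q) r !=set0.
  by move=> /(_ _ nq) [p [Cp [bp pr]]]; exists (b p); split => //; exists p.
move=> nE; apply: (@null_set_nonseparating R k (b q) r
  (b @` (chart_dom b `&` A)) (b @` (chart_dom b `&` B))).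
- exact: chart_image_open_subset.
- exact: chart_image_open_subset.
- apply/seteqP; split=> // z [[[p [bp Ap] pz] [p' [bp' Bp'] p'z]] _].
  have pp' : p = p' by rewrite -(chart_mapK bp) pz -p'z chart_mapK.
  by have : (A `&` B) p; [split => //; rewrite pp'|rewrite AB0].
- exact: meets.
- exact: meets.
- apply: null_set_sub nE => z [/rD [p bp pz] nAB].
  by exists p => //; split => // -[Ap|Bp]; apply: nAB; [left|right]; exists p.
Qed.

Theorem corollary1p1 (R : realType) (m n : nat) (M : manifold R m)
    (N : manifold R n) (f : M -> N)
    (N_connected : connected [set: N])
    (f_C1 : C1_map f)
    (f_regular : exists p : M, regular_point f p)
    (f_closed : closed (range f))
    (f_critical : (dim_subset (critical_set f) < (n%:R - 1)%:E)%E) :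
  forall y : N, exists x : M, f x = y.
Proof.
have [k [s [nk s0 sk nC]]] := dim_subset_lt_null f_critical.
subst n.
move=> y; apply: contrapT => fy.
pose A := (range f)°; pose B := ~` range f.
have oA : open A by apply: open_interior.
have oB : open B by apply: closed_openC.
have [q Aq nAq] : exists2 q, closure A q & ~ A q.
  apply: contrapT => h.
  have cA : closed A by move=> q Aq; apply: contrapT => nAq; apply: h; exists q.
  have AT : A = setT.
    apply: N_connected.
    - by have [p reg] := f_regular; exists (f p); apply: regular_point_interior.
    - by exists A; rewrite ?setTI.
    - by exists A; rewrite ?setTI.
  have : A y by rewrite AT.
  by move=> /interior_subset [x _ xy]; apply: fy; exists x.
have Bq : closure B q by rewrite closure_setC.
have AB0 : A `&` B = set0.
  by apply/seteqP; split => // z [/interior_subset].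
have [b Ab] := null_boundary_chart oA oB AB0 Aq Bq; apply.
apply: null_set_sub (null_set_C1_image f_C1 s0 sk nC Ab) => _ [p [nAB bp] <-].
exists p => //; split => //.
have [x _ xp] : range f p by apply: contrapT => ?; apply: nAB; right.
exists x => // reg; apply: nAB; left; rewrite -xp.
exact: regular_point_interior.
Qed.
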